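(* Let $\mathcal{H}$ be a real Hilbert space and let $f:\mathcal{H}\to\mathbb{R}\cup\{+\infty\}$ be proper, convex, lower semicontinuous with $\operatorname{argmin} f\neq\emptyset$; let $x^*$ be the element of minimal norm of $\operatorname{argmin} f$. Let $\alpha,c>0$, $0<q<1$, $1<p<q+1$, and assume that either [$p-q-1<\delta<0$ and $\lambda>0$] or [$\delta=0$ and $\lambda\in\,]0,1[$]. For $k\ge1$ put $\alpha_k=1-\frac{\alpha}{k^q}$, $c_k=\frac{c}{k^p}$, $\lambda_k=\lambda k^\delta$. Let $x_0,x_1\in\mathcal H$ and let $(x_k)$ be generated by $$x_{k+1}=\operatorname{prox}_{\lambda_k f}\big(x_k+\alpha_k(x_k-x_{k-1})-c_kx_k\big),\quad k\ge1.$$ Then $\liminf_{k\to+\infty}\|x_k-x^*\|=0$. Further, if either $\|x_k\|<\|x^*\|$ for all sufficiently large $k$, or $\|x_k\|\ge\|x^*\|$ for all sufficiently large $k$, then $(x_k)$ converges strongly to $x^*$.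
   Context: For $s>0$, $\operatorname{prox}_{sf}(x)=\operatorname{argmin}_{y\in\mathcal H}\left(f(y)+\frac{1}{2s}\|y-x\|^2\right)$. The minimal norm element of $\operatorname{argmin} f$ is the projection of $0$ onto this nonempty closed convex set. *)

(* Defs.v *)
From HB Require Import structures.
From mathcomp Require Export all_boot all_order all_algebra sesquilinear.
From mathcomp Require Export all_classical all_reals all_analysis.

Set Implicit Arguments.
Unset Strict Implicit.
Unset Printing Implicit Defensive.

Export Order.TTheory GRing.Theory Num.Theory.
Export numFieldNormedType.Exports.

Local Open Scope classical_set_scope.
Local Open Scope ring_scope.

Definition proper_fun {R : realType} {T : Type} (f : T -> \bar R) : Prop :=
  (forall x, f x != -oo%E) /\ (exists x, f x != +oo%E).

(* [convex_function] of the library only covers functions with values in R. *)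
Definition econvex_function {R : realType} {E : lmodType R}
    (f : E -> \bar R) : Prop :=
  forall (x y : E) (t : R), 0 < t < 1 ->
    (f ((1 - t) *: x + t *: y)%R <= (1 - t)%:E * f x + t%:E * f y)%E.

Definition argmin {R : realType} {T : Type} (f : T -> \bar R) : set T :=
  [set x | forall y, (f x <= f y)%E].

(* In a Hilbert space, for f proper, convex and lower semicontinuous and s > 0,
   the argmin is a singleton; [get] returns its element (and the default value
   [point] if the argmin is empty). *)
Definition prox {R : realType} {H : normedModType R} (s : R)
    (f : H -> \bar R) (x : H) : H :=
  get (argmin (fun y => (f y + ((2 * s)^-1 * `|y - x| ^+ 2)%R%:E)%E)).

(* Same convention: the nearest point exists and is unique when A is a nonempty
   closed convex subset of a Hilbert space. *)
Definition proj {R : realType} {H : normedModType R} (A : set H) (x : H) : H :=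
  get [set y | A y /\ forall z, A z -> `|y - x| <= `|z - x|].

(* Main.v *)
(* The whole sequence converges strongly to the minimal norm minimizer z.  Put
   d_k = x_k - x_(k-1), u_k = x_k - z, g_k = alpha / k^q, F = f - min f, and
     L_k = |d_k|^2 / 2 + lambda_k F(x_k) + c_k / 2 (|x_k|^2 - |z|^2)
           + a_k (1 - g_k) <d_k, u_k> + a_k g_k / 2 |u_k|^2
   with a_k = kappa / k^s, s = max(q, p - q) < 1 and kappa small.  Testing the
   optimality condition of the proximal step against x_k and against z gives
     (1 + a_k) L_(k+1) <= L_k + (c_k - c_(k+1)) |z|^2.
   Since k a_k -> oo while c_k - c_(k+1) = O(c_k / k), this forces the limsup of
   L_k / c_k to be <= 0.  As L_k dominates
   lambda_k F(x_k) + c_k / 2 (|x_k|^2 - |z|^2) and lambda_k / c_k -> oo, we get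
   F(x_k) -> 0 and limsup |x_k| <= |z|.  Finally, almost minimizers of f of norm
   at most |z| up to a small error are close to z: the Tikhonov path prox_(n f) 0
   converges to a minimizer whose norm is the limit of the minimal norms over the
   sublevel sets of f. *)
Require Import Defs.
From mathcomp Require Import ring lra.

Set Implicit Arguments.
Unset Strict Implicit.

Local Open Scope classical_set_scope.
Local Open Scope ring_scope.

(** * Real inequalities behind the energy recursion *)

(* One step of the descent, written in the Gram matrix of e = x_k - x_(k-1),
   d = x_(k+1) - x_k, u = x_k - z and z; primes denote the index k + 1. *)
Lemma energy_step (R : realFieldType) (K g g' c c' l l' a a' F F' : R)
    (ee dd uu zz ed eu ud zu zd : R) :
  1 <= K -> 0 <= a' <= a -> a <= g / 16 -> a * g <= c / 16 ->
  16 * c <= g <= 1 -> 0 <= g' <= g -> 16 <= K ^+ 2 * c -> 0 < c' <= c ->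
  l' <= l -> 0 <= F' ->
  a - a' <= 2 * a / K -> a * g - a' * g' <= 2 * a / K ->
  0 <= ee -> 0 <= dd -> 0 <= zz ->
  0 <= ee + dd - 2 * ed -> 0 <= ee + dd + 2 * ed ->
  0 <= uu -> 0 <= uu + 2 * ud + dd -> 0 <= uu - 2 * ud + dd ->
  (forall t, 0 <= dd + 2 * t * (ud + dd) + t ^+ 2 * (uu + 2 * ud + dd)) ->
  0 <= uu + 2 * ud + dd + 2 * (zu + zd) + zz ->
  - (1 - g) * ed + c * (ud + zd) + dd <= l * (F - F') ->
  - (1 - g) * (eu + ed) + c * (uu + ud + zu + zd) + ud + dd <= - l * F' ->
  (1 + a) * (dd / 2 + l' * F' + c' / 2 * (uu + 2 * ud + dd + 2 * (zu + zd)) +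
     a' * (1 - g') * (ud + dd) + a' * g' / 2 * (uu + 2 * ud + dd)) <=
  ee / 2 + l * F + c / 2 * (uu + 2 * zu) + a * (1 - g) * eu + a * g / 2 * uu
  + (c - c') * zz.
Proof.
move=> K1 /andP[a'0 a'a] ag agc /andP[cg g1] /andP[g'0 g'g] Kc /andP[c'0 c'c].
have a0 : 0 <= a := le_trans a'0 a'a.
have g0 : 0 <= g := le_trans g'0 g'g.
have c0 : 0 < c := lt_le_trans c'0 c'c.
have K0 : 0 < K := lt_le_trans ltr01 K1.
have og0 : 0 <= 1 - g by rewrite subr_ge0.
have og1 : 1 - g <= 1 by rewrite gerBl.
have ag16 : 16 * a <= g by move: ag; clear; lra.
have c16 : c <= 1 / 16 by move: cg g1; clear; lra.
have a1 : a <= 1 by move: ag g1; clear; lra.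
have cc : 0 <= c - c' by rewrite subr_ge0.
have e'e : a' * g' <= a * g by apply: ler_pM.
have e'0 : 0 <= a' * g' by apply: mulr_ge0.
have e'c : a' * g' <= c / 16 := le_trans e'e agc.
have b'0 : 0 <= a' * (1 - g') by rewrite mulr_ge0 // subr_ge0 (le_trans g'g).
have b'a : a' * (1 - g') <= a.
  by apply: le_trans a'a; rewrite ler_piMr // gerBl.
have aa : a * a <= c / 256.
  have : a * a <= a * (g / 16) by apply: ler_wpM2l.
  by move: agc; clear; lra.
have aM : a / K >= 0 by rewrite divr_ge0 // ltW.
move=> ll F'0 va ve ee0 dd0 zz0 ed1 ed2 uu0.
set U := uu + 2 * ud + dd; set P := ud + dd => U0 V0 PT X0.
(* Young's inequality for [P = <d, u + d>] and [U = |u + d|^2], from the quadratic hypothesis at [t]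
   and [- t]. *)
have PU t : 2 * t * `|P| <= dd + t ^+ 2 * U.
  by have := PT t; have := PT (- t); case: (ger0P P) => _; rewrite sqrrN;
    clear; lra.
set b' := a' * (1 - g') in b'0 b'a *.
set e' := a' * g' in e'e e'0 e'c ve *.
have S2 : (b' - a * (1 - g)) * P <= a * c / 16 * U + a * dd.
  have bM : `|b' - a * (1 - g)| <= 2 * a / K.
    by rewrite ler_norml /b' !mulrBr !mulr1 -/e'; apply/andP; split;
      move: va ve e'e a'a aM; clear; lra.
  have MP : 2 * a / K * `|P| <= a * c / 16 * U + a * dd.
    (* Young's inequality with the weight [t = c K / 16]. *)
    set t := c * K / 16.
    have t0 : 0 < t by rewrite /t divr_gt0 // mulr_gt0.
    have k0 : 0 <= a / (K * t) by rewrite divr_ge0 // mulr_ge0 ?ltW.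
    have := ler_wpM2l k0 (PU t).
    have -> : a / (K * t) * (2 * t * `|P|) = 2 * a / K * `|P|.
      by field; rewrite !gt_eqF.
    have -> : a / (K * t) * (dd + t ^+ 2 * U)
        = a * c / 16 * U + a * dd * (16 / (K ^+ 2 * c)).
      by rewrite /t; field; rewrite !gt_eqF.
    move=> /le_trans; apply; rewrite lerD2l ler_piMr ?mulr_ge0 //.
    by rewrite ler_pdivrMr ?mul1r // mulr_gt0 // exprn_gt0.
  apply: le_trans MP; apply: le_trans (ler_norm _) _; rewrite normrM.
  exact: ler_wpM2r.
have S3 : a * (b' * P) <= a * (dd / 2 + a * a * U / 2).
  apply: ler_wpM2l => //; apply: (@le_trans _ _ (a * `|P|)).
    by apply: le_trans (ler_norm _) _; rewrite normrM (ger0_norm b'0) ler_wpM2r.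
  by have := PU a; rewrite expr2; clear; lra.
have S4 : e' * U <= a * g * U by apply: ler_wpM2r.
have S5 : a * (e' * U) <= a * (c / 16 * U).
  by apply: ler_wpM2l => //; apply: ler_wpM2r.
have S6 : a * (a * a * U) <= a * (c / 256 * U).
  by apply: ler_wpM2l => //; apply: ler_wpM2r.
have S7 : (1 + a) * (l' * F') <= (1 + a) * (l * F').
  by apply: ler_wpM2l; [exact: addr_ge0|exact: ler_wpM2r].
have S8 : (1 + a) * (c' / 2 * (U + 2 * (zu + zd))) <=
          (1 + a) * (c / 2 * (U + 2 * (zu + zd))) + (c - c') * zz.
  have h : 0 <= (1 + a) * ((c - c') / 2 * (U + 2 * (zu + zd) + zz)).
    by rewrite mulr_ge0 ?addr_ge0 // mulr_ge0 // divr_ge0.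
  have h2 : a * ((c - c') * zz) <= 1 * ((c - c') * zz).
    by apply: ler_wpM2r => //; apply: mulr_ge0.
  by move: h h2; clear; lra.
(* By [D7] the friction leaves a dissipation [g (ee + dd) / 2]. As [16 a <= g] and [16 c <= g], it
   absorbs the errors in [dd] and [ee]. *)
have D1 : 16 * a * dd <= g * dd by apply: ler_wpM2r.
have D2 : 16 * c * dd <= g * dd by apply: ler_wpM2r.
have D3 : a * (c * dd) <= a * (1 / 16 * dd).
  by apply: ler_wpM2l => //; apply: ler_wpM2r.
have D4 : 16 * a * ee <= g * ee by apply: ler_wpM2r.
have D5 : 0 <= a * g * dd by rewrite !mulr_ge0.
have D6 : 0 <= a * (c * U) by rewrite !mulr_ge0 // ltW.
have D7 : 0 <= (1 - g) * (ee + dd - 2 * ed) by rewrite mulr_ge0.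
have D8 : a * ((1 - g) * ed) <= a * ((ee + dd) / 2).
  apply: ler_wpM2l => //; apply: (@le_trans _ _ `|ed|).
    by apply: le_trans (ler_norm _) _; rewrite normrM ger0_norm // ler_piMl.
  by case: (ger0P ed) => _; move: ed1 ed2; clear; lra.
have D9 : 0 <= a * dd by rewrite mulr_ge0.
have D10 : 0 <= a * (c * (uu - 2 * ud + dd)) by rewrite !mulr_ge0 // ltW.
have D11 : 0 <= a * (c * uu) by rewrite !mulr_ge0 // ltW.
have D12 : 0 <= a * ee by rewrite mulr_ge0.
(* The test against [x_k] is added to [a] times the test against [z]. The latter leaves
   [a c uu / 2], which pays for the multiples of [U] because [D10] gives [U <= 2 uu + 2 dd] up to
   the factor [a c]. *)
move=> I1 /(ler_wpM2l a0).
rewrite /U /P in S2 S3 S4 S5 S6 S8 D6 *.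
clear - S2 S3 S4 S5 S6 S7 S8 D1 D2 D3 D4 D5 D6 D7 D8 D9 D10 D11 D12 I1.
lra.
Qed.

(** With [T k = L k - e / 2 * c k], the perturbation and the drift of [c] cost [O(c k / k)], while
    the factor [1 + a k] gains a multiple of [a k * c k]. Since [k a k] tends to infinity,
    eventually [(1 + a k) T k.+1 <= T k], so [T] is at most [O(k^-3)], negligible against
    [c0 / k^2]. *)
Lemma perturbed_contraction_littleo (R : realType) (L c a : nat -> R) (C c0 : R) :
  0 < c0 -> 0 <= C ->
  (\forall k \near \oo, (1 + a k) * L k.+1 <= L k + C * (c k / k%:R)) ->
  (\forall k \near \oo, c k - c k.+1 <= 2 * c k / k%:R) ->
  (\forall k \near \oo, c0 / k%:R ^+ 2 <= c k) ->
  (forall M, \forall k \near \oo, M <= k%:R * a k) ->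
  forall e, 0 < e -> \forall k \near \oo, L k <= e * c k.
Proof.
move=> c00 C0 HL Hc Hc0 Ha e e0.
set e' := e / 2; have e'0 : 0 < e' by rewrite divr_gt0.
pose T k := L k - e' * c k.
have HT : \forall k \near \oo,
    [/\ 4 <= k%:R :> R, 7 <= k%:R * a k & (1 + a k) * T k.+1 <= T k].
  near=> k.
  have k4 : 4 <= k%:R :> R by near: k; exact: nbhs_infty_ger.
  have k0 : 0 < k%:R :> R by lra.
  have ka7 : 7 <= k%:R * a k by near: k; exact: Ha.
  (* Twice [2 + C / e']: from [4 <= k], the term [2 a k] takes at most half of [k a k]. *)
  have ka : 2 * (C / e') + 4 <= k%:R * a k by near: k; exact: Ha.
  have h1 : (1 + a k) * L k.+1 <= L k + C * (c k / k%:R) by near: k.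
  have h2 : c k - c k.+1 <= 2 * c k / k%:R by near: k.
  have h3 : 0 <= c k.
    apply: (@le_trans _ _ (c0 / k%:R ^+ 2)); last by near: k.
    by rewrite divr_ge0 ?exprn_ge0 // ltW.
  split => //; rewrite /T mulrBr lerBlDr; apply: (le_trans h1).
  have a0 : 0 <= a k by rewrite -(pmulr_rge0 _ k0); lra.
  have h4 : (1 + a k) * (e' * (c k - 2 * c k / k%:R)) <=
      (1 + a k) * (e' * c k.+1).
    apply: ler_wpM2l; first by lra.
    by apply: ler_wpM2l; [exact: ltW|lra].
  suff : C * (c k / k%:R) + e' * c k <= (1 + a k) * (e' * (c k - 2 * c k / k%:R)).
    by lra.
  rewrite -subr_ge0.
  have -> : (1 + a k) * (e' * (c k - 2 * c k / k%:R)) - (C * (c k / k%:R) + e' * c k)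
    = e' * (c k / k%:R) * (k%:R * a k - 2 * a k - 2 - C / e').
    by field; rewrite !gt_eqF.
  apply: mulr_ge0.
    by apply: mulr_ge0; [exact: ltW|rewrite divr_ge0 // ltW].
  have h5 : 4 * a k <= k%:R * a k by apply: ler_wpM2r.
  by lra.
case: HT => N _ HT.
have N4 : 4 <= N%:R :> R by case: (HT N (leqnn N)).
have N0 : 0 < N%:R :> R by lra.
(* [T N] may be negative; the induction multiplies by [B] and needs [0 <= B]. *)
pose B := Num.max 0 (T N) * N%:R ^+ 3.
have B0 : 0 <= B by rewrite mulr_ge0 ?exprn_ge0 ?le_max ?lexx.
(* [1 + a k >= 1 + 7 / k >= (1 + 1 / k) ^ 3], hence the cubic decay. *)
have HB : forall j, T (N + j)%N <= B / (N + j)%:R ^+ 3.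
  elim=> [|j IH].
    by rewrite addn0 /B mulfK ?le_max ?lexx ?orbT // expf_neq0 // gt_eqF.
  have [k4 ka hT] := HT (N + j)%N (leq_addr _ _).
  rewrite addnS; move: IH k4 ka hT; set k := (N + j)%N => IH k4 ka hT.
  have k0 : 0 < k%:R :> R by lra.
  have a0 : 0 <= a k by rewrite -(pmulr_rge0 _ k0); lra.
  rewrite -(@ler_pM2l _ (1 + a k)); last by lra.
  apply: (le_trans hT); apply: (le_trans IH).
  rewrite mulrCA ler_wpM2l // ler_pdivlMr ?exprn_gt0 ?ltr0n //.
  rewrite mulrC ler_pdivrMr ?exprn_gt0 //.
  rewrite -natr1; set x := k%:R in k0 k4 ka *.
  have : x ^+ 2 * 7 <= x ^+ 2 * (x * a k) by rewrite ler_wpM2l // sqr_ge0.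
  have : 4 * x <= x * x by rewrite ler_wpM2r // ltW.
  by rewrite !exprS expr0 !mulr1; lra.
near=> k.
have kN : (N <= k)%N by near: k; exact: nbhs_infty_ge.
have k0 : 0 < k%:R :> R by case: (HT k kN); lra.
have := HB (k - N)%N; rewrite subnKC // /T => h.
have h1 : c0 / k%:R ^+ 2 <= c k by near: k.
have h2 : B / (e' * c0) <= k%:R by near: k; exact: nbhs_infty_ger.
suff : B / k%:R ^+ 3 <= e' * c k by rewrite /e' in h *; lra.
apply: (@le_trans _ _ (e' * (c0 / k%:R ^+ 2))); last by rewrite ler_pM2l.
rewrite ler_pdivrMr ?exprn_gt0 //.
have -> : e' * (c0 / k%:R ^+ 2) * k%:R ^+ 3 = k%:R * (e' * c0).
  by field; rewrite gt_eqF.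
by rewrite -ler_pdivrMr // mulr_gt0.
Unshelve. all: by end_near.
Qed.

(** * Growth and slow variation of real powers *)

Lemma near_powR_ge (R : realType) (s M : R) : 0 < s ->
  \forall k \near \oo, M <= k%:R `^ s.
Proof.
move=> s0; near=> k.
have M1 : 0 <= Num.max M 0 by rewrite le_max lexx orbT.
apply: (@le_trans _ _ (Num.max M 0)); first by rewrite le_max lexx.
have -> : Num.max M 0 = (Num.max M 0 `^ s^-1) `^ s.
  by rewrite -powRrM mulVf ?gt_eqF // powRr1.
apply: ge0_ler_powR; rewrite ?nnegrE ?powR_ge0 ?(ltW s0) //.
by near: k; exact: nbhs_infty_ger.
Unshelve. all: by end_near.
Qed.

(** With [t = 1 / k]: [(1 + t)^s <= (1 + t)^2] and [(1 - 2 t) (1 + t)^2 <= 1]. *)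
Lemma powRV_succ (R : realType) (s : R) (k : nat) : 0 <= s <= 2 -> (0 < k)%N ->
  (k%:R `^ s)^-1 - (k.+1%:R `^ s)^-1 <= 2 / k%:R * (k%:R `^ s)^-1.
Proof.
move=> /andP[s0 s2] k0.
have K0 : 0 < k%:R :> R by rewrite ltr0n.
set t := (k%:R)^-1 : R; have t0 : 0 < t by rewrite invr_gt0.
have A0 : 0 < k%:R `^ s :> R by rewrite powR_gt0.
have A'0 : 0 < k.+1%:R `^ s :> R by rewrite powR_gt0.
have A'A : k.+1%:R `^ s <= k%:R `^ s * (1 + t) ^+ 2.
  have -> : k.+1%:R = k%:R * (1 + t) :> R.
    by rewrite mulrDr mulr1 /t divff ?gt_eqF // natr1.
  rewrite powRM ?(ltW K0) //; last by lra.
  rewrite ler_pM2l // -powR_mulrn; last by lra.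
  by apply: ler_powR => //; lra.
rewrite lerBlDr -lerBlDl -[X in X - _]mul1r -mulrBl ler_pdivrMr //.
rewrite ler_pdivlMl // -/t mulrC.
have [t1|t1] := ltP (1 - 2 * t) 0.
  by apply: le_trans (ltW A0); rewrite nmulr_rle0 // ltW.
apply: (le_trans (ler_wpM2l t1 A'A)).
rewrite mulrCA -[leRHS]mulr1 ler_pM2l // -subr_ge0.
rewrite (_ : _ - _ = t ^+ 2 * (3 + 2 * t)); last by ring.
by rewrite mulr_ge0 ?exprn_ge0 //; lra.
Qed.

(** * Extended-valued convex functions and limits of sequences *)

Lemma argmin_fin (R : realType) (T : Type) (f : T -> \bar R) (z : T) :
  proper_fun f -> argmin f z -> exists m, f z = m%:E.
Proof.
move=> [fNy [w fw]] zmin; move: (fNy z) (zmin w) (fNy w) fw.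
by case: (f z) => [r _ _ _ _||] //; [exists r|case: (f w)].
Qed.

(** Working with real upper bounds, that is on the epigraph, keeps later computations in [R]
    wherever [f] may be infinite. *)
Lemma econvex_le (R : realType) (H : normedModType R) (f : H -> \bar R)
    (f_convex : econvex_function f) (x y : H) (a b t : R) : 0 < t < 1 ->
  (f x <= a%:E)%E -> (f y <= b%:E)%E ->
  (f ((1 - t) *: x + t *: y)%R <= ((1 - t) * a + t * b)%:E)%E.
Proof.
move=> t01 fx fy; apply: (le_trans (f_convex _ _ _ t01)).
case/andP: t01 => t0 t1.
rewrite [leRHS](_ : _ = ((1 - t)%:E * a%:E + t%:E * b%:E)%E) //.
by rewrite leeD // lee_wpmul2l // lee_fin; lra.
Qed.

(** If [s < f l], a real [a] strictly between separates them: [f] exceeds [a] near [l], while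
    [t n < a] eventually. *)
Lemma lsc_cvg_le (R : realType) (H : normedModType R) (f : H -> \bar R)
    (f_lsc : lower_semicontinuous f) (y : nat -> H) (l : H) (t : nat -> R) (s : R) :
  y @ \oo --> l -> t @ \oo --> s -> (forall n, (f (y n) <= (t n)%:E)%E) ->
  (f l <= s%:E)%E.
Proof.
move=> yl ts fy; rewrite leNgt; apply/negP => sl.
have [a sa al] : exists2 a, s < a & (a%:E < f l)%E.
  case: (f l) sl => [r| |] //.
    by rewrite lte_fin => sr; exists ((s + r) / 2); rewrite ?lte_fin; lra.
  by move=> _; exists (s + 1); rewrite ?ltry //; lra.
have [V lV VP] := f_lsc _ _ al.
near \oo => n.
have : (a%:E < f (y n))%E by apply: VP; near: n; exact: yl.
apply/negP; rewrite -leNgt; apply: (le_trans (fy n)).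
by rewrite lee_fin ltW //; near: n; exact: (cvgr_lt s).
Unshelve. all: by end_near.
Qed.

(** Squares, because both the minimizing sequences of the proximal objective and the Tikhonov path
    come with bounds on squared distances. *)
Lemma sqdist_cauchy_cvg (R : realType) (H : completeNormedModType R)
    (y : nat -> H) (r : nat -> R) :
  r @ \oo --> 0 -> (forall n m, (n <= m)%N -> `|y m - y n| ^+ 2 <= r n) ->
  cvgn y.
Proof.
move=> r0 yr; apply: cauchy_cvg; apply: cauchy_exP => e e0.
have [N _ rN] : \forall n \near \oo, r n < e ^+ 2.
  by apply: (cvgr_lt 0) => //; rewrite exprn_gt0.
exists (y N); exists N => // n /= Nn; rewrite -ball_normE /= distrC.
rewrite -(@ltr_pXn2r _ 2) ?nnegrE // ?(ltW e0) //.
exact: le_lt_trans (yr _ _ Nn) (rN _ (leqnn _)).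
Qed.

(** * Inner product identities *)

Lemma ip_sym (R : realType) (H : normedModType R) (ip : {dot H for idfun}) u v :
  ip u v = ip v u.
Proof. by rewrite hermC expr0 mul1r. Qed.

Lemma ipE (R : realType) (H : normedModType R) (ip : {dot H for idfun}) :
  ((((forall u v w : H, ip (u + v)%R w = (ip u w + ip v w)%R) *
  (forall u v w : H, ip w (u + v)%R = (ip w u + ip w v)%R)) *
  ((forall u w : H, ip (- u)%R w = (- ip u w)%R) *
   (forall u w : H, ip w (- u)%R = (- ip w u)%R))) *
  ((forall (t : R) (u w : H), ip (t *: u)%R w = (t * ip u w)%R) *
   (forall (t : R) (u w : H), ip w (t *: u)%R = (t * ip w u)%R)))%type.
Proof.
split; [split|]; split=> *; [exact: linearDl|exact: linearDr|exact: linearNl|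
  exact: linearNr|exact: linearZl_LR|exact: linearZr_LR].
Qed.

Section Hilbert.
Variables (R : realType) (H : completeNormedModType R) (ip : {dot H for idfun}).
Hypothesis hip : forall u : H, ip u u = `|u| ^+ 2.

Lemma normD_sqr (u v : H) :
  `|u + v| ^+ 2 = `|u| ^+ 2 + 2 * ip u v + `|v| ^+ 2.
Proof. by rewrite -!hip !(ipE ip) (ip_sym ip v u); ring. Qed.

Lemma normB_sqr (u v : H) :
  `|u - v| ^+ 2 = `|u| ^+ 2 - 2 * ip u v + `|v| ^+ 2.
Proof. by rewrite normD_sqr (ipE ip) normrN; ring. Qed.

(** The parallelogram law, with the weights of [econvex_le] at [t = 2^-1]. *)
Lemma norm_midpoint_sqr (u v x : H) :
  `|(1 - 2^-1) *: u + 2^-1 *: v - x| ^+ 2 =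
  (`|u - x| ^+ 2 + `|v - x| ^+ 2) / 2 - `|u - v| ^+ 2 / 4.
Proof.
rewrite -!hip !(ipE ip) (ip_sym ip v u) (ip_sym ip x u) (ip_sym ip x v).
by field.
Qed.

(** * Existence and optimality condition of the proximal point *)

(** Direct method: by the parallelogram law, the midpoint of two almost minimizers beats their
    average by [k / 4] times their squared distance, so a minimizing sequence is Cauchy; lower
    semicontinuity handles its limit. *)
Lemma prox_objective_argmin (f : H -> \bar R) (m s : R) (x : H) :
  proper_fun f -> econvex_function f -> lower_semicontinuous f ->
  (forall y, (m%:E <= f y)%E) -> 0 < s ->
  argmin (fun y => (f y + ((2 * s)^-1 * `|y - x| ^+ 2)%R%:E)%E) !=set0.
Proof.
move=> [fNy [y0 fy0]] f_convex f_lsc fm s0; set k := (2 * s)^-1.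
have k0 : 0 < k by rewrite invr_gt0 mulr_gt0.
(* The real upper bounds of values of the objective, so that the infimum is taken in [R]. *)
pose S := [set v : R | exists y, (f y <= (v - k * `|y - x| ^+ 2)%:E)%E].
have fin y : (f y != +oo)%E -> exists t, f y = t%:E.
  by move: (fNy y); case: (f y) => // t _ _; exists t.
have Sinf : has_inf S.
  split.
    have [t ft] := fin _ fy0; exists (t + k * `|y0 - x| ^+ 2), y0.
    by rewrite ft lee_fin addrK.
  exists m => v [y /(le_trans (fm y))]; rewrite lee_fin => h.
  have : 0 <= k * `|y - x| ^+ 2 by rewrite mulr_ge0 ?exprn_ge0 // ltW.
  by lra.
set i := inf S.
have Si v : S v -> i <= v by apply: ge_inf; case: Sinf.
pose e n : R := n.+1%:R^-1.
have ex n : exists y, (f y <= (i + e n - k * `|y - x| ^+ 2)%:E)%E.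
  have e0 : 0 < e n by rewrite /e invr_gt0.
  have [v [y Sv] vi] := inf_adherent e0 Sinf.
  by exists y; apply: (le_trans Sv); rewrite lee_fin lerD2r ltW.
have [y fy] := choice ex.
have ecvg : e @ \oo --> 0 by exact: cvg_harmonic.
have ydist n p : (n <= p)%N -> `|y p - y n| ^+ 2 <= 4 / k * e n.
  move=> np.
  have ep : e p <= e n by rewrite /e lef_pV2 ?posrE // ler_nat.
  have t01 : 0 < (2^-1 : R) < 1 by apply/andP; split; lra.
  have := econvex_le f_convex t01 (fy p) (fy n).
  set q := (_ *: _ + _)%R => fq.
  have : i <= i + (e n + e p) / 2 - k * (`|y p - y n| ^+ 2 / 4).
    apply: Si; exists q; apply: (le_trans fq).
    by rewrite lee_fin norm_midpoint_sqr; lra.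
  by move=> h; rewrite mulrAC ler_pdivlMr //; lra.
have /cvg_ex[l yl] : cvgn y.
  apply: (sqdist_cauchy_cvg _ ydist).
  by rewrite -[0](mulr0 (4 / k)); apply: cvgMr.
have fl : (f l <= (i - k * `|l - x| ^+ 2)%:E)%E.
  apply: (lsc_cvg_le f_lsc yl _ fy).
  rewrite -{2}[i]addr0; apply: cvgB; first exact: cvgD (cvg_cst _) _.
  apply: cvgMr; rewrite expr2; under eq_fun do rewrite expr2.
  by apply: cvgM; apply: cvg_norm; apply: cvgB => //; exact: cvg_cst.
exists l => w /=.
apply: (@le_trans _ _ i%:E).
  by rewrite -(subrK (k * `|l - x| ^+ 2) i) EFinD leeD2r.
have [->|/fin [t ft]] := eqVneq (f w) +oo%E; first by rewrite addye // leey.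
by rewrite ft -EFinD lee_fin; apply: Si; exists w; rewrite ft addrK.
Qed.

(** [(x - P) / s] is a subgradient of [f] at [P]: compare [P] with the points [P + th (w - P)] for
    small [th]. *)
Lemma prox_subgradient (f : H -> \bar R) (m s : R) (x : H) :
  proper_fun f -> econvex_function f -> lower_semicontinuous f ->
  (forall y, (m%:E <= f y)%E) -> 0 < s ->
  let P := prox s f x in
  exists2 r : R, f P = r%:E &
    forall w t, (f w <= t%:E)%E -> r + s^-1 * ip (x - P) (w - P) <= t.
Proof.
move=> f_proper f_convex f_lsc fm s0 P.
have : argmin (fun y => (f y + ((2 * s)^-1 * `|y - x| ^+ 2)%R%:E)%E) P.
  (* Existence excludes the default value of [get]. *)
  apply: getPex.
  have [y hy] := prox_objective_argmin x f_proper f_convex f_lsc fm s0.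
  by exists y.
rewrite /argmin /=; set k := (2 * s)^-1 => Pmin.
have k0 : 0 < k by rewrite invr_gt0 mulr_gt0.
case: f_proper => fNy [y0 fy0].
have [r fP] : exists r, f P = r%:E.
  move: (fNy P) (Pmin y0) (fNy y0) fy0.
  by case: (f P) => [r _ _ _ _||] //; [exists r|case: (f y0)].
exists r => // w t fw.
set A := t - (r + s^-1 * ip (x - P) (w - P)).
set B := k * `|w - P| ^+ 2.
have B0 : 0 <= B by rewrite mulr_ge0 ?exprn_ge0 // ltW.
have AB th : 0 < th < 1 -> 0 <= A + th * B.
  move=> th01; case/andP: (th01) => th0 th1.
  have frP : (f P <= r%:E)%E by rewrite fP.
  have hc := econvex_le f_convex th01 frP fw.
  have := le_trans (Pmin _) (leeD2r _ hc).
  rewrite fP -!EFinD lee_fin.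
  have -> : (1 - th) *: P + th *: w - x = th *: (w - P) - (x - P).
    rewrite scalerBl scale1r scalerBr opprB -addrA [P - _]addrC addrACA.
    by rewrite [- _ + _]addrC.
  have -> : `|th *: (w - P) - (x - P)| ^+ 2 =
      th ^+ 2 * `|w - P| ^+ 2 - 2 * th * ip (x - P) (w - P) + `|x - P| ^+ 2.
    move: (w - P) (x - P) => v u.
    by rewrite -!hip !(ipE ip) (ip_sym ip v u); ring.
  rewrite (distrC P x) => h.
  rewrite -(pmulr_rge0 _ th0) /A /B.
  have -> : s^-1 = 2 * k by rewrite /k; field; rewrite gt_eqF.
  by lra.
rewrite -subr_ge0 -/A leNgt; apply/negP => A0.
have D0 : 0 < B - 2 * A by lra.
(* An explicit small [th]: if [A < 0], it makes [A + th * B] negative. *)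
have th01 : 0 < - A / (B - 2 * A) < 1.
  by rewrite divr_gt0 ?ltr_pdivrMr //=; lra.
have := AB _ th01.
have -> : A + - A / (B - 2 * A) * B = - (2 * A ^+ 2 / (B - 2 * A)).
  by field; rewrite gt_eqF.
apply/negP; rewrite oppr_ge0 -ltNge divr_gt0 //.
by rewrite mulr_gt0 // exprn_even_gt0 //= lt_eqF.
Qed.

(** * The Tikhonov path and stability of the minimal norm minimizer *)

(* [y] is the limit of the Tikhonov path [prox n f 0]. *)
Lemma argmin_norm_lower_limit (f : H -> \bar R) (z : H) (m : R) :
  proper_fun f -> econvex_function f -> lower_semicontinuous f ->
  argmin f z -> f z = m%:E ->
  exists2 y, argmin f y & forall e, 0 < e -> exists2 eta, 0 < eta &
    forall x, (f x <= (m + eta)%:E)%E -> `|y| ^+ 2 - e <= `|x| ^+ 2.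
Proof.
move=> f_proper f_convex f_lsc fz fzm.
have fm y : (m%:E <= f y)%E by rewrite -fzm.
pose y (n : nat) : H := prox n.+1%:R f 0.
(* The subgradient inequality at [y n], polarized. The rest uses only its instances at other path
   points, at [z] and at [x]. *)
have [r fy yP] : exists2 r : nat -> R, (forall n, f (y n) = (r n)%:E) &
    forall n w t, (f w <= t%:E)%E ->
      2 * n.+1%:R * (r n - t) + `|y n| ^+ 2 + `|w - y n| ^+ 2 <= `|w| ^+ 2.
  have H1 n : exists t : R, f (y n) = t%:E /\ forall w u, (f w <= u%:E)%E ->
      2 * n.+1%:R * (t - u) + `|y n| ^+ 2 + `|w - y n| ^+ 2 <= `|w| ^+ 2.
    have n0 : 0 < n.+1%:R :> R by rewrite ltr0n.
    have [t ft tP] := prox_subgradient 0 f_proper f_convex f_lsc fm n0.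
    exists t; split=> // w u /tP.
    rewrite -/(y n) sub0r normB_sqr -!hip !(ipE ip) (ip_sym ip w (y n)).
    rewrite -(@ler_pM2l _ n.+1%:R) // mulrDr mulrA mulfV ?mul1r; last by rewrite gt_eqF.
    by lra.
  have [r rP] := choice H1; exists r => n; first by case: (rP n).
  by case: (rP n).
have rm n : m <= r n by rewrite -lee_fin -fy.
(* Adding the inequalities for [n] and [p], each tested at the other point, gives
   [|y n - y p|^2 <= (p - n) (r n - r p)]. *)
have rdec n p : (n <= p)%N -> r p <= r n.
  rewrite leq_eqVlt => /predU1P[->//|np].
  have := yP n (y p) (r p); rewrite fy lexx => /(_ isT).
  have := yP p (y n) (r n); rewrite fy lexx => /(_ isT).
  rewrite (distrC (y p)) => h1 h2.
  have h3 : 0 <= `|y n - y p| ^+ 2 by rewrite exprn_ge0.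
  have d0 : 0 < p.+1%:R - n.+1%:R :> R by rewrite subr_gt0 ltr_nat ltnS.
  by rewrite -subr_ge0 -(pmulr_rge0 _ d0); lra.
have ydist n p : (n <= p)%N -> `|y p - y n| ^+ 2 <= `|y p| ^+ 2 - `|y n| ^+ 2.
  move=> np; have := yP n (y p) (r p); rewrite fy lexx => /(_ isT).
  have : 0 <= 2 * n.+1%:R * (r n - r p).
    by rewrite mulr_ge0 // subr_ge0 rdec.
  by lra.
have yz n : `|y n| ^+ 2 <= `|z| ^+ 2.
  have := yP n z m; rewrite fzm lexx => /(_ isT).
  have : 0 <= 2 * n.+1%:R * (r n - m) by rewrite mulr_ge0 // subr_ge0.
  have : 0 <= `|z - y n| ^+ 2 by rewrite exprn_ge0.
  by lra.
pose N n := `|y n| ^+ 2.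
have Ninc : nondecreasing_seq N.
  move=> n p np; rewrite /N -subr_ge0; apply: le_trans (ydist _ _ np).
  by rewrite exprn_ge0.
have Ncvg : cvgn N.
  apply: nondecreasing_is_cvgn => //; exists (`|z| ^+ 2) => _ [n _ <-].
  exact: yz.
have NS n : N n <= limn N by apply: nondecreasing_cvgn_le.
set S := limn N in NS.
have NS' : N @ \oo --> S by [].
have /cvg_ex[l yl] : cvgn y.
  apply: (@sqdist_cauchy_cvg _ _ _ (fun n => S - N n)).
    by rewrite -(subrr S); apply: cvgB => //; exact: cvg_cst.
  by move=> n p np; apply: (le_trans (ydist _ _ np)); rewrite lerD2r NS.
have lS : `|l| ^+ 2 = S.
  apply: (@cvg_unique _ _ (N @ \oo)) => //.
  rewrite (_ : N = fun n => `|y n| * `|y n|) ?expr2; last exact/funext.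
  by apply: cvgM; apply: cvg_norm.
have fl : (f l <= m%:E)%E.
  apply: (@lsc_cvg_le _ _ _ f_lsc y l (fun n => m + `|z| ^+ 2 / 2 * n.+1%:R^-1)) => //.
    rewrite -{2}[m]addr0 -(mulr0 (`|z| ^+ 2 / 2)); apply: cvgD; first exact: cvg_cst.
    by apply: cvgMr; exact: cvg_harmonic.
  move=> n; rewrite fy lee_fin -lerBlDl ler_pdivlMr // ler_pdivlMr //.
  have := yP n z m; rewrite fzm lexx => /(_ isT).
  have : 0 <= `|z - y n| ^+ 2 by rewrite exprn_ge0.
  have : 0 <= `|y n| ^+ 2 by rewrite exprn_ge0.
  by lra.
exists l => [w|e e0]; first exact: le_trans fl _.
have [n _ nN] : \forall n \near \oo, S - e / 2 < N n.
  by apply: (cvgr_gt S) => //; lra.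
(* Chosen so that [2 (n + 1) eta = e / 2]; the other half of [e] is the gap between [S] and
   [N n]. *)
exists (e / (4 * n.+1%:R)) => [|x fx]; first by rewrite divr_gt0 // mulr_gt0.
have := yP n _ _ fx; have := nN n (leqnn n); rewrite lS /N => h1 h2.
have h3 : 0 <= `|x - y n| ^+ 2 by rewrite exprn_ge0.
have h4 : 0 <= 2 * n.+1%:R * (r n - m) by rewrite mulr_ge0 // subr_ge0.
have h5 : 2 * n.+1%:R * (e / (4 * n.+1%:R)) = e / 2 by field; rewrite gt_eqF // ltr0n.
by move: h2 h4 h5; set eta := e / _; lra.
Qed.

(** The midpoint of [x] and [z] is again an almost minimizer, so its norm cannot be much below
    [|z|]; the parallelogram law then forces [x] to be close to [z]. *)
Lemma proj_argmin_stable (f : H -> \bar R) (z : H) :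
  proper_fun f -> econvex_function f -> lower_semicontinuous f ->
  argmin f !=set0 -> z = proj (argmin f) 0 ->
  argmin f z /\ forall m, f z = m%:E ->
  forall e, 0 < e -> exists2 eta, 0 < eta &
    forall x, (f x <= (m + eta)%:E)%E -> `|x| ^+ 2 <= `|z| ^+ 2 + eta ->
    `|x - z| <= e.
Proof.
move=> f_proper f_convex f_lsc [z0 z0min] zproj.
have [m0 fz0] := argmin_fin f_proper z0min.
have [y ymin yP] := argmin_norm_lower_limit f_proper f_convex f_lsc z0min fz0.
have fargmin w : argmin f w -> f w = m0%:E.
  by move=> wmin; rewrite -fz0; apply/eqP; rewrite eq_le wmin z0min.
have [zmin zle] : [set y | argmin f y /\ forall z, argmin f z ->
    `|y - 0| <= `|z - 0|] z.
  (* The projection is genuine: [y] has minimal norm, since every minimizer lies in all the sublevel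
     sets of [yP]. *)
  rewrite zproj; apply: getPex; exists y; split=> // w wmin.
  rewrite !subr0 -(@ler_pXn2r _ 2) ?nnegrE //.
  apply/ler_addgt0Pr => e e0; have [eta eta0 /(_ w)] := yP e e0.
  by rewrite fargmin // lee_fin lerDl (ltW eta0) => /(_ isT); lra.
split=> // m; rewrite fargmin // => -[<-] e e0.
have e20 : 0 < e ^+ 2 by rewrite exprn_gt0.
(* In [|x - z|^2 / 4] the lower limit contributes [e^2 / 8], and the norm excess [eta' / 2] at most
   [e^2 / 8]. *)
have [|eta eta0 etaP] := yP (e ^+ 2 / 8); first by rewrite divr_gt0.
exists (Num.min eta (e ^+ 2 / 4)).
  by rewrite lt_min eta0 divr_gt0.
set eta' := Num.min _ _ => x fx xz.
have h1 : eta' <= eta by rewrite ge_min lexx.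
have h2 : eta' <= e ^+ 2 / 4 by rewrite ge_min lexx orbT.
have t01 : 0 < (2^-1 : R) < 1 by apply/andP; split; lra.
have fz : (f z <= (m0 + eta)%:E)%E by rewrite fargmin // lee_fin; lra.
have fx' : (f x <= (m0 + eta)%:E)%E by apply: (le_trans fx); rewrite lee_fin; lra.
have := econvex_le f_convex t01 fx' fz.
rewrite (_ : (1 - 2^-1) * (m0 + eta) + 2^-1 * (m0 + eta) = m0 + eta); last by field.
move=> /etaP; have := norm_midpoint_sqr x z 0; rewrite !subr0 => -> h3.
have h4 : `|z| ^+ 2 <= `|y| ^+ 2.
  by rewrite ler_pXn2r ?nnegrE //; have := zle y ymin; rewrite !subr0.
rewrite -(@ler_pXn2r _ 2) ?nnegrE ?(ltW e0) //.
by lra.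
Qed.

(** * Energy descent and convergence for general parameters *)

Lemma energy_descent (f : H -> \bar R) (z xp x xn : H)
    (K g g' c c' l l' a a' m F F' : R) :
  proper_fun f -> econvex_function f -> lower_semicontinuous f ->
  argmin f z -> f z = m%:E ->
  1 <= K -> 0 <= a' <= a -> a <= g / 16 -> a * g <= c / 16 ->
  16 * c <= g <= 1 -> 0 <= g' <= g -> 16 <= K ^+ 2 * c -> 0 < c' <= c ->
  0 < l -> l' <= l ->
  a - a' <= 2 * a / K -> a * g - a' * g' <= 2 * a / K ->
  xn = prox l f (x + (1 - g) *: (x - xp) - c *: x) ->
  f x = (m + F)%:E -> f xn = (m + F')%:E ->
  (1 + a) * (`|xn - x| ^+ 2 / 2 + l' * F' + c' / 2 * (`|xn| ^+ 2 - `|z| ^+ 2)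
     + a' * (1 - g') * ip (xn - x) (xn - z) + a' * g' / 2 * `|xn - z| ^+ 2) <=
  `|x - xp| ^+ 2 / 2 + l * F + c / 2 * (`|x| ^+ 2 - `|z| ^+ 2)
     + a * (1 - g) * ip (x - xp) (x - z) + a * g / 2 * `|x - z| ^+ 2
  + (c - c') * `|z| ^+ 2.
Proof.
move=> f_proper f_convex f_lsc zmin fz K1 ha ag agc hc hg Kc hc' l0 ll va ve.
move=> xnE fx fxn.
have fm y : (m%:E <= f y)%E by rewrite -fz.
have [r] := prox_subgradient (x + (1 - g) *: (x - xp) - c *: x)
  f_proper f_convex f_lsc fm l0.
rewrite -xnE fxn => -[<-] sg.
have F'0 : 0 <= F' by have := fm xn; rewrite fxn lee_fin lerDl.
have scal A B s : s + l^-1 * A <= B -> A <= l * (B - s).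
  by rewrite -(ler_pM2l l0) mulrDr mulrA divff ?gt_eqF // mul1r; lra.
have I1 := scal _ _ _ (sg x (m + F) _); rewrite fx lexx in I1.
have I2 := scal _ _ _ (sg z m _); rewrite fz lexx in I2.
move: {I1 I2} (I1 isT) (I2 isT) {sg}.
(* Everything is expressed through [e], [d], [u], [z], whose inner products become the scalars of
   [energy_step]. *)
set e := x - xp; set d := xn - x; set u := x - z.
have xE : x = u + z by rewrite subrK.
have xnuE : xn = u + d + z by rewrite addrAC -xE addrC subrK.
have nE v : `|v| ^+ 2 = ip v v by rewrite hip.
have ip0 v : 0 <= ip v v by rewrite hip exprn_ge0.
have unE : xn - z = u + d by rewrite xnuE addrK.
have dE : x + (1 - g) *: e - c *: x - xn = (1 - g) *: e - c *: x - d.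
  by rewrite /d opprB -!addrA addrCA; congr +%R; exact: addrCA.
have zE : z - xn = - (u + d) by rewrite -unE opprB.
have xnxE : x - xn = - d by rewrite /d opprB.
rewrite unE dE zE xnxE xnuE xE !nE => {unE dE zE xnxE xnuE xE}.
clearbody e d u.
have sym := (ip_sym ip d u, ip_sym ip u e, ip_sym ip d e, ip_sym ip z u,
  ip_sym ip z d, ip_sym ip z e).
rewrite !(ipE ip) !sym.
move=> I1 I2.
have := @energy_step R K g g' c c' l l' a a' F F' (ip e e) (ip d d) (ip u u)
  (ip z z) (ip e d) (ip e u) (ip u d) (ip u z) (ip d z) K1 ha ag agc hc hg Kc hc'
  ll F'0 va ve (ip0 _) (ip0 _) (ip0 _).
clear K1 ha ag agc hc hg Kc hc' ll va ve F'0 l0 scal fm.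
have := ip0 (e - d); have := ip0 (e + d); have := ip0 (u + d); have := ip0 (u - d).
have := ip0 (u + d + z).
have PT t := ip0 (d + t *: (u + d)).
rewrite !(ipE ip) !sym => X0 V0 U0 ed2 ed1.
move=> /(_ ltac:(lra) ltac:(lra) (ip0 _) ltac:(lra) ltac:(lra)).
have {}PT t : 0 <= ip d d + 2 * t * (ip u d + ip d d) +
    t ^+ 2 * (ip u u + 2 * ip u d + ip d d).
  by have := PT t; rewrite !(ipE ip) !sym; clear; lra.
move=> /(_ PT ltac:(lra) ltac:(lra) ltac:(lra)).
by clear; lra.
Qed.

(** Isolates what the parameters must satisfy: pointwise comparisons, relative variation of order
    [1 / k], and the divergence of [k a k] and [l k / c k]. *)
Lemma inertial_prox_tikhonov_cvg (f : H -> \bar R) (z : H) (x : nat -> H)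
    (g c l a : nat -> R) :
  proper_fun f -> econvex_function f -> lower_semicontinuous f ->
  argmin f !=set0 -> z = proj (argmin f) 0 ->
  (\forall k \near \oo,
    [/\ 0 <= a k.+1 <= a k, a k <= g k / 16, a k * g k <= c k / 16,
        16 * c k <= g k <= 1 & 0 <= g k.+1 <= g k]) ->
  (\forall k \near \oo,
    [/\ 16 <= k%:R ^+ 2 * c k, 0 < c k.+1 <= c k, 0 < l k & l k.+1 <= l k]) ->
  (\forall k \near \oo,
    [/\ a k - a k.+1 <= 2 * a k / k%:R,
        a k * g k - a k.+1 * g k.+1 <= 2 * a k / k%:R &
        c k - c k.+1 <= 2 * c k / k%:R]) ->
  (forall M, \forall k \near \oo, M <= k%:R * a k) ->
  (forall M, \forall k \near \oo, M * c k <= l k) ->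
  (\forall k \near \oo,
    x k.+1 = prox (l k) f (x k + (1 - g k) *: (x k - x k.-1) - c k *: x k)) ->
  x @ \oo --> z.
Proof.
move=> f_proper f_convex f_lsc f_argmin zproj h1 h2 h3 ka lc hx.
have [zmin stable] := proj_argmin_stable f_proper f_convex f_lsc f_argmin zproj.
have [m fz] := argmin_fin f_proper zmin.
have {}stable := stable m fz.
have fm y : (m%:E <= f y)%E by rewrite -fz.
pose F k := fine (f (x k)) - m.
(* Finiteness of [f] is known only at outputs of the proximal map, hence the shifted index. *)
have fx' : \forall k \near \oo, f (x k.+1) = (m + F k.+1)%:E.
  near=> k.
  have l0 : 0 < l k by have [] : [/\ 16 <= k%:R ^+ 2 * c k, 0 < c k.+1 <= c k,
    0 < l k & l k.+1 <= l k] by near: k.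
  have xE : x k.+1 =
    prox (l k) f (x k + (1 - g k) *: (x k - x k.-1) - c k *: x k) by near: k.
  have [r] := prox_subgradient (x k + (1 - g k) *: (x k - x k.-1) - c k *: x k)
    f_proper f_convex f_lsc fm l0.
  by rewrite -xE /F => -> _; rewrite addrC subrK.
have fx : \forall k \near \oo, f (x k) = (m + F k)%:E.
  by move: fx' => [N _ HN]; exists N.+1 => // -[|k] //= Nk; exact: HN.
pose L k := `|x k - x k.-1| ^+ 2 / 2 + l k * F k
  + c k / 2 * (`|x k| ^+ 2 - `|z| ^+ 2)
  + a k * (1 - g k) * ip (x k - x k.-1) (x k - z) + a k * g k / 2 * `|x k - z| ^+ 2.
have Ldec : \forall k \near \oo,
    (1 + a k) * L k.+1 <= L k + 2 * `|z| ^+ 2 * (c k / k%:R).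
  near=> k.
  have [] : [/\ 0 <= a k.+1 <= a k, a k <= g k / 16, a k * g k <= c k / 16,
        16 * c k <= g k <= 1 & 0 <= g k.+1 <= g k] by near: k.
  have [] : [/\ 16 <= k%:R ^+ 2 * c k, 0 < c k.+1 <= c k, 0 < l k & l k.+1 <= l k].
    by near: k.
  have [] : [/\ a k - a k.+1 <= 2 * a k / k%:R,
        a k * g k - a k.+1 * g k.+1 <= 2 * a k / k%:R &
        c k - c k.+1 <= 2 * c k / k%:R] by near: k.
  move=> va ve vc Kc hc l0 ll ha ag agc hcg hg.
  have K1 : 1 <= k%:R :> R by near: k; exact: nbhs_infty_ger.
  have h : (c k - c k.+1) * `|z| ^+ 2 <= 2 * c k / k%:R * `|z| ^+ 2.
    by apply: ler_wpM2r => //; rewrite exprn_ge0.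
  have fxk : f (x k) = (m + F k)%:E by near: k.
  have fxk1 : f (x k.+1) = (m + F k.+1)%:E by near: k.
  have xE : x k.+1 =
    prox (l k) f (x k + (1 - g k) *: (x k - x k.-1) - c k *: x k) by near: k.
  have := energy_descent f_proper f_convex f_lsc zmin fz K1 ha ag agc hcg hg Kc
    hc l0 ll va ve xE fxk fxk1.
  by rewrite /L /=; lra.
(* Complete the square with [b = a (1 - g)]; the remainder is nonnegative because [b^2 <= a g]. *)
have Llow : \forall k \near \oo,
    l k * F k + c k / 2 * (`|x k| ^+ 2 - `|z| ^+ 2) <= L k.
  near=> k.
  have [] : [/\ 0 <= a k.+1 <= a k, a k <= g k / 16, a k * g k <= c k / 16,
        16 * c k <= g k <= 1 & 0 <= g k.+1 <= g k] by near: k.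
  move=> /andP[a'0 a'a] ag _ /andP[_ g1] _.
  rewrite /L; move: (x k - x k.-1) (x k - z) => d u.
  have a0 : 0 <= a k by apply: le_trans a'a.
  have b0 : 0 <= a k * (1 - g k) by rewrite mulr_ge0 //; lra.
  have q0 : 0 <= `|d + (a k * (1 - g k)) *: u| ^+ 2 by rewrite exprn_ge0.
  have ba : (a k * (1 - g k)) ^+ 2 <= a k * g k.
    have : a k * (1 - g k) <= a k * 1 by apply: ler_wpM2l => //; lra.
    have : a k * a k <= a k * g k by apply: ler_wpM2l => //; lra.
    rewrite mulr1 => p1 p2; apply: le_trans p1.
    by rewrite expr2; apply: ler_pM.
  have : (a k * (1 - g k)) ^+ 2 * `|u| ^+ 2 <= a k * g k * `|u| ^+ 2.
    by apply: ler_wpM2r; rewrite ?exprn_ge0.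
  move: q0; rewrite normD_sqr (ipE ip).
  rewrite (_ : `|_ *: u| ^+ 2 = (a k * (1 - g k)) ^+ 2 * `|u| ^+ 2); last first.
    by rewrite -!hip !(ipE ip); ring.
  by lra.
apply/cvgrPdist_le => e e0; have [eta eta0 etaP] := stable e e0.
(* Makes [l F <= c (eta + |z|^2) / 2 = M c eta <= l eta], hence [F <= eta]. *)
pose M := (eta + `|z| ^+ 2) / (2 * eta).
have z0 : 0 <= `|z| ^+ 2 by rewrite exprn_ge0.
have kc : \forall k \near \oo, 16 / k%:R ^+ 2 <= c k.
  near=> k; rewrite ler_pdivrMr; last first.
    by rewrite exprn_gt0 // ltr0n; near: k; exact: nbhs_infty_gt.
  by rewrite mulrC; near: k; apply: filterS h2 => k [].
have Lc : \forall k \near \oo, L k <= eta / 2 * c k.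
  apply: (perturbed_contraction_littleo _ _ Ldec _ kc ka) => //.
  - by apply: filterS h3 => k [].
  - by rewrite divr_gt0.
near=> k.
rewrite distrC; apply: etaP.
all: have hL : L k <= eta / 2 * c k by near: k.
all: have hl : l k * F k + c k / 2 * (`|x k| ^+ 2 - `|z| ^+ 2) <= L k by near: k.
all: have lM : M * c k <= l k by near: k; exact: lc.
all: have fxk : f (x k) = (m + F k)%:E by near: k.
all: have F0 : 0 <= F k by have := fm (x k); rewrite fxk lee_fin lerDl.
all: have [_ /andP[c'0 c'c] l0 _] : [/\ 16 <= k%:R ^+ 2 * c k, 0 < c k.+1 <= c k,
    0 < l k & l k.+1 <= l k] by near: k.
all: have c0 : 0 < c k := lt_le_trans c'0 c'c.
- rewrite fxk lee_fin lerD2l -(ler_pM2l l0).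
  have : 0 <= c k * `|x k| ^+ 2 by rewrite mulr_ge0 ?exprn_ge0 // ltW.
  have : M * c k * eta <= l k * eta by rewrite ler_pM2r.
  rewrite (_ : M * c k * eta = c k * (eta + `|z| ^+ 2) / 2); last first.
    by rewrite /M; field; rewrite gt_eqF.
  by lra.
- have lF : 0 <= l k * F k by rewrite mulr_ge0 // ltW.
  by rewrite -(ler_pM2l c0); lra.
Unshelve. all: by end_near.
Qed.

End Hilbert.

(** * The power-law parameters *)

Unset Implicit Arguments.

Theorem theorem3p2 (R : realType) (H : completeNormedModType R)
    (ip : {dot H for idfun}) (hip : forall u : H, ip u u = `|u| ^+ 2)
    (f : H -> \bar R) (f_proper : proper_fun f) (f_convex : econvex_function f)
    (f_lsc : lower_semicontinuous f) (argmin_f : argmin f !=set0)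
    (xstar : H) (hxstar : xstar = proj (argmin f) 0)
    (alpha c p q delta lambda : R)
    (alpha_gt0 : 0 < alpha) (c_gt0 : 0 < c)
    (hq : 0 < q < 1) (hp : 1 < p < q + 1)
    (hdelta : (p - q - 1 < delta < 0 /\ 0 < lambda) \/
              (delta = 0 /\ 0 < lambda < 1))
    (x : nat -> H)
    (hx : forall k : nat, (1 <= k)%N ->
       let alpha_k := 1 - alpha / k%:R `^ q in
       let c_k := c / k%:R `^ p in
       let lambda_k := lambda * k%:R `^ delta in
       x k.+1 = prox lambda_k f
                  (x k + alpha_k *: (x k - x k.-1) - c_k *: x k)) :
  limn_einf (fun k => `|x k - xstar|%:E) = 0%E /\
  ((\forall k \near \oo, `|x k| < `|xstar|) \/
   (\forall k \near \oo, `|xstar| <= `|x k|) ->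
   x @ \oo --> xstar).
Proof.
suff xcvg : x @ \oo --> xstar.
  split=> //; have [//|-> //] := @cvg_limn_einf_sup _ (fun k => `|x k - xstar|%:E) 0%E.
  apply: cvg_EFin; first by near=> k.
  rewrite -(normr0 H) -(subrr xstar).
  by apply: cvg_norm; apply: cvgB => //; exact: cvg_cst.
(* In the first alternative, [delta + p > 2 p - q - 1 > 0]. *)
have {hdelta} [dp l0 d0] : [/\ 0 < delta + p, 0 < lambda & delta <= 0].
  by case: hdelta => [[/andP[? ?] ?]|[-> /andP[? ?]]]; split; lra.
have [/andP[q0 q1] /andP[p1 pq]] := (hq, hp).
(* [q <= s] serves [a <= g / 16], [p - q <= s] serves [a g <= c / 16], and [s < 1] makes [k a]
   diverge. The two terms of [kappa] are the matching constants. *)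
pose s := Num.max q (p - q).
have qs : q <= s by rewrite le_max lexx.
have pqs : p - q <= s by rewrite le_max lexx orbT.
have s1 : s < 1 by rewrite gt_max q1; lra.
pose kappa := Num.min (alpha / 16) (c / (16 * alpha)).
have kappa0 : 0 < kappa by rewrite lt_min !divr_gt0 ?mulr_gt0.
have kappa_alpha : kappa <= alpha / 16 by rewrite ge_min lexx.
have kappa_c : kappa * alpha <= c / 16.
  rewrite -ler_pdivlMr // (_ : _ / alpha = c / (16 * alpha)).
    by rewrite ge_min lexx orbT.
  by field; rewrite gt_eqF.
have ltV (a b : R) k : 0 <= a -> 0 <= b -> (0 < k)%N ->
    0 <= a / k.+1%:R `^ b <= a / k%:R `^ b.
  move=> a0 b0 k0; rewrite divr_ge0 ?powR_ge0 //= ler_wpM2l //.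
  rewrite lef_pV2 ?posrE ?powR_gt0 ?ltr0n //.
  by apply: ge0_ler_powR; rewrite ?nnegrE ?ler_nat.
have stepV (a b : R) k : 0 <= a -> 0 <= b <= 2 -> (0 < k)%N ->
    a / k%:R `^ b - a / k.+1%:R `^ b <= 2 * (a / k%:R `^ b) / k%:R.
  move=> a0 hb k0; rewrite -mulrBr.
  apply: (le_trans (ler_wpM2l a0 (powRV_succ hb k0))).
  by rewrite le_eqVlt; apply/orP; left; apply/eqP; ring.
have p02 : 0 <= p <= 2 by lra.
have p0 : 0 <= p by lra.
have s02 : 0 <= s <= 2 by lra.
have s0 : 0 <= s by lra.
have sq02 : 0 <= s + q <= 2 by lra.
have psq : p <= s + q by lra.
have dn0 : 0 <= - delta by rewrite oppr_ge0.
have [pq0 p20 s10] : [/\ 0 < p - q, 0 < 2 - p & 0 < 1 - s] by split; lra.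
apply: (inertial_prox_tikhonov_cvg hip
  (f := f) (g := fun k => alpha / k%:R `^ q) (c := fun k => c / k%:R `^ p)
  (l := fun k => lambda * k%:R `^ delta) (a := fun k => kappa / k%:R `^ s)) => //.
- near=> k.
  have k0 : (0 < k)%N by near: k; exact: nbhs_infty_gt.
  have K0 : 0 < k%:R :> R by rewrite ltr0n.
  have K1 : 1 <= k%:R :> R by rewrite ler1n.
  have Kn0 : k%:R != 0 :> R by rewrite gt_eqF.
  have Q0 : 0 < k%:R `^ q :> R by rewrite powR_gt0.
  have S0 : 0 < k%:R `^ s :> R by rewrite powR_gt0.
  have P0 : 0 < k%:R `^ p :> R by rewrite powR_gt0.
  have X0 : 0 < k%:R `^ (p - q) :> R by rewrite powR_gt0.
  have Qa : alpha <= k%:R `^ q by near: k; exact: near_powR_ge.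
  have PQ : k%:R `^ p = k%:R `^ q * k%:R `^ (p - q) :> R.
    by rewrite -powRD ?Kn0 ?implybT // addrC subrK.
  have D : 16 * c / alpha <= k%:R `^ (p - q) by near: k; exact: near_powR_ge.
  split.
  + by apply: ltV; rewrite // ltW.
  + rewrite [leRHS]mulrAC ler_pM ?invr_ge0 ?(ltW kappa0) ?(ltW S0) //.
    by rewrite lef_pV2 ?posrE // ler_powR.
  + rewrite mulrACA -invfM [leRHS]mulrAC.
    rewrite ler_pM ?invr_ge0 ?mulr_ge0 ?(ltW kappa0) ?(ltW S0) ?(ltW Q0) ?(ltW alpha_gt0) //.
    rewrite lef_pV2 ?posrE ?mulr_gt0 // -powRD ?Kn0 ?implybT //.
    by rewrite ler_powR.
  + rewrite ler_pdivrMr // mul1r Qa andbT ler_pdivlMr // PQ.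
    rewrite [leLHS](_ : _ = 16 * c / k%:R `^ (p - q)); last first.
      by field; rewrite !gt_eqF.
    by rewrite ler_pdivrMr // -ler_pdivrMl // mulrC.
  + by apply: ltV; rewrite // ltW.
- near=> k.
  have k0 : (0 < k)%N by near: k; exact: nbhs_infty_gt.
  have K0 : 0 < k%:R :> R by rewrite ltr0n.
  have Kn0 : k%:R != 0 :> R by rewrite gt_eqF.
  have P2 : 16 / c <= k%:R `^ (2 - p) by near: k; exact: near_powR_ge.
  split.
  + rewrite -powR_mulrn ?(ltW K0) // mulrCA -ler_pdivrMl // mulrC.
    by rewrite -powRB // Kn0 implybT.
  + rewrite divr_gt0 ?powR_gt0 ?ltr0n //=.
    have /andP[] // : 0 <= c / k.+1%:R `^ p <= c / k%:R `^ p.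
    by apply: ltV; rewrite // ltW.
  + by rewrite mulr_gt0 // powR_gt0.
  + rewrite ler_pM2l //.
    have : 0 <= (1 : R) / k.+1%:R `^ (- delta) <= 1 / k%:R `^ (- delta).
      by apply: ltV; rewrite // ltW.
    by rewrite !powRN !invrK !mul1r => /andP[].
- near=> k.
  have k0 : (0 < k)%N by near: k; exact: nbhs_infty_gt.
  have Qa : alpha <= k%:R `^ q by near: k; exact: near_powR_ge.
  split; [by apply: stepV; rewrite // ltW| |by apply: stepV; rewrite // ltW].
  (* The product [a g] is a single power, so [stepV] bounds its variation by [2 a g / k]; then
     [g <= 1] for large [k]. *)
  have prodE j : (0 < j)%N -> kappa / j%:R `^ s * (alpha / j%:R `^ q) =
      kappa * alpha / j%:R `^ (s + q).
    move=> j0; rewrite powRD; last by rewrite pnatr_eq0 -lt0n j0 implybT.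
    by rewrite mulrACA -invfM.
  rewrite !prodE //; apply: (le_trans (stepV _ _ _ _ _ _)) => //.
    by rewrite mulr_ge0 // ltW.
  rewrite -prodE // ler_pM2r ?invr_gt0 ?ltr0n // ler_pM2l //.
  rewrite ler_piMr ?divr_ge0 ?(ltW kappa0) ?powR_ge0 //.
  by rewrite ler_pdivrMr ?mul1r // powR_gt0 // ltr0n.
- move=> M; near=> k.
  have k0 : (0 < k)%N by near: k; exact: nbhs_infty_gt.
  have K0 : 0 < k%:R :> R by rewrite ltr0n.
  have Kn0 : k%:R != 0 :> R by rewrite gt_eqF.
  rewrite [leRHS](_ : _ = kappa * k%:R `^ (1 - s)); last first.
    by rewrite powRB ?Kn0 ?implybT // (powRr1 (ltW K0)) mulrCA.
  rewrite -ler_pdivrMl //.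
  by near: k; exact: near_powR_ge.
- move=> M; near=> k.
  have k0 : (0 < k)%N by near: k; exact: nbhs_infty_gt.
  have K0 : 0 < k%:R :> R by rewrite ltr0n.
  have Kn0 : k%:R != 0 :> R by rewrite gt_eqF.
  rewrite mulrA ler_pdivrMr ?powR_gt0 // -mulrA -powRD ?Kn0 ?implybT //.
  rewrite -ler_pdivrMl // mulrC.
  by near: k; exact: near_powR_ge.
- near=> k; rewrite hx //.
  by near: k; exact: nbhs_infty_gt.
Unshelve. all: by end_near.
Qed.
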